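(* For all integers $s,t$ with $3\leq s\leq t$, the complete bipartite graph $K_{s,t}$ satisfies $rx_3(K_{s,t})\leq \min\{6,\,s+t-3\}$. Moreover, the bound is tight: there exist integers $3\le s\le t$ with $rx_3(K_{s,t})= \min\{6,\,s+t-3\}$.
   Context: Graphs are finite, simple and undirected. Edge colorings are arbitrary (adjacent edges may receive the same color). In an edge-colored graph $G$, a tree $T\subseteq G$ (a subgraph that is a tree) is a rainbow tree if no two edges of $T$ have the same color. For a connected graph $G$ of order $n\ge 3$, a $3$-rainbow coloring of $G$ is an edge coloring such that for every set $S$ of $3$ vertices of $G$ there is a rainbow tree $T$ in $G$ with $S\subseteq V(T)$. The $3$-rainbow index $rx_3(G)$ is the minimum number of colors in a $3$-rainbow coloring of $G$. *)

(* Defs.v *)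
From HB Require Import structures.
From mathcomp Require Import all_boot.

Set Implicit Arguments.
Unset Strict Implicit.
Unset Printing Implicit Defensive.

Record sgraph := SGraph {
  vertex :> finType;
  adj : rel vertex;
  adj_sym : symmetric adj;
  adj_irrefl : irreflexive adj
}.

(* An edge is the two-element set of its endpoints. *)
Definition edges (G : sgraph) : {set {set G}} :=
  [set [set x; y] | x in G, y in G & adj x y].

Definition edge_rel (G : sgraph) (F : {set {set G}}) : rel G :=
  [rel x y | [set x; y] \in F].

Definition is_subgraph (G : sgraph) (V : {set G}) (F : {set {set G}}) : Prop :=
  F \subset edges G /\ cover F \subset V.

Definition is_connected (G : sgraph) (V : {set G}) (F : {set {set G}}) : Prop :=
  V != set0 /\ {in V &, forall x y, connect (edge_rel F) x y}.

(* [:: x; y] is a [ucycle] whenever xy is an edge, so that the cycles of the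
   graph are the [ucycle]s of size at least 3. *)
Definition is_acyclic (G : sgraph) (F : {set {set G}}) : Prop :=
  forall p : seq G, ucycle (edge_rel F) p -> size p < 3.

Definition is_tree (G : sgraph) (V : {set G}) (F : {set {set G}}) : Prop :=
  [/\ is_subgraph V F, is_connected V F & is_acyclic F].

(* A coloring is a function on all sets of vertices, but only its values on
   [edges G] are ever used. *)
Definition is_rainbow_tree (G : sgraph) (C : Type) (c : {set G} -> C)
    (V : {set G}) (F : {set {set G}}) : Prop :=
  is_tree V F /\ {in F &, injective c}.

Definition is_3rainbow_coloring (G : sgraph) (C : Type) (c : {set G} -> C)
    : Prop :=
  forall S : {set G}, #|S| = 3 ->
    exists (V : {set G}) (F : {set {set G}}),
      is_rainbow_tree c V F /\ S \subset V.

Definition has_3rainbow_coloring (G : sgraph) (k : nat) : Prop :=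
  exists c : {set G} -> 'I_k, is_3rainbow_coloring c.

(* [is_rx3 G k] means rx_3(G) = k. *)
Definition is_rx3 (G : sgraph) (k : nat) : Prop :=
  has_3rainbow_coloring G k /\
  (forall j : nat, has_3rainbow_coloring G j -> k <= j).

Section CompleteBipartite.
Variables s t : nat.

Definition Kst_adj : rel ('I_s + 'I_t)%type :=
  fun u v => match u, v with
             | inl _, inr _ | inr _, inl _ => true
             | _, _ => false
             end.

Lemma Kst_adj_sym : symmetric Kst_adj.
Proof. by move=> [i|i] [j|j]. Qed.

Lemma Kst_adj_irrefl : irreflexive Kst_adj.
Proof. by move=> [i|i]. Qed.

Definition Kst : sgraph := SGraph Kst_adj_sym Kst_adj_irrefl.

End CompleteBipartite.

(* Main.v *)
(* For s + t >= 9 six colors suffice: split each side into three classes, two of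
   which are single vertices, and let the color of an edge depend only on the
   classes of its endpoints, through a suitable 3 x 3 matrix. A triple meets
   the third class of a side in at most three vertices, so up to an automorphism
   of the colored graph it lies in a K_{m,n} with m, n in {3,4,5}, where a finite
   list of rainbow trees covers all triples. Otherwise (s,t) is (3,3), (3,4),
   (3,5) or (4,4), and an explicit coloring with s + t - 3 colors is checked in
   the same way. The bound is attained by K_{3,3}: a tree containing the three
   vertices of one side has at least three edges. *)
Require Import Defs.
From HB Require Import structures.
From mathcomp Require Import all_boot.
From Stdlib Require Import Classical.

Set Implicit Arguments.
Unset Strict Implicit.
Unset Printing Implicit Defensive.

(** * Growing a tree by one leaf *)

Lemma edge_relE (G : sgraph) (F : {set {set G}}) (x y : G) :
  edge_rel F x y = ([set x; y] \in F).
Proof. by []. Qed.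

Lemma is_tree1 (G : sgraph) (x : G) : is_tree [set x] set0.
Proof.
split.
- split; first by rewrite sub0set.
  by rewrite /cover big_set0 sub0set.
- split; first by apply/set0Pn; exists x; rewrite inE.
  by move=> y z; rewrite !inE => /eqP -> /eqP ->.
- move=> p; case: p => [|y [|z [|u p]]] //=.
  by rewrite /ucycle /= edge_relE in_set0.
Qed.

(** In the enlarged edge set the only neighbour of [v] is [u]. A cycle of length at least 3 through
    [v] would therefore visit [u] twice, and a cycle avoiding [v] uses old edges only. *)
Lemma is_tree_leaf (G : sgraph) (V : {set G}) (F : {set {set G}}) (u v : G) :
  is_tree V F -> u \in V -> v \notin V -> adj u v ->
  is_tree (v |: V) ([set u; v] |: F).
Proof.
move=> [[sFE sFV] [V0 conV] acyF] uV vV uv.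
have edgeV x y : edge_rel F x y -> (x \in V) && (y \in V).
  rewrite edge_relE => xyF.
  have /subsetP sxy := subset_trans (bigcup_sup (F := id) _ xyF) sFV.
  by rewrite !sxy ?inE ?eqxx ?orbT.
have sub1 : subrel (edge_rel F) (edge_rel ([set u; v] |: F)).
  by move=> x y xy; rewrite edge_relE inE [_ \in F]xy orbT.
have uvF : edge_rel ([set u; v] |: F) u v by rewrite edge_relE !inE eqxx.
have vuF : edge_rel ([set u; v] |: F) v u by rewrite edge_relE !inE setUC eqxx.
have eq_edge x y : edge_rel ([set u; v] |: F) x y -> x != v -> y != v ->
    edge_rel F x y.
  rewrite edge_relE in_setU1 => /orP [/eqP xy|//] xv yv.
  have: v \in [set x; y] by rewrite xy !inE eqxx orbT.
  by rewrite !inE eq_sym (negPf xv) eq_sym (negPf yv).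
have nbr y : edge_rel ([set u; v] |: F) v y -> y = u.
  rewrite edge_relE in_setU1 => /orP [/eqP E|/edgeV /andP [vV' _]]; last first.
    by rewrite vV' in vV.
  have: u \in [set v; y] by rewrite E !inE eqxx.
  rewrite !inE => /orP [/eqP uv'|/eqP //].
  by rewrite -uv' uV in vV.
have edgeC x y : edge_rel ([set u; v] |: F) x y -> edge_rel ([set u; v] |: F) y x.
  by rewrite !edge_relE [[set y; x]]setUC.
split.
- split.
    rewrite subUset sFE andbT sub1set.
    by apply/imset2P; exists u v; rewrite ?inE.
  rewrite /cover bigcup_setU big_set1 subUset; apply/andP; split.
    by rewrite subUset !sub1set !inE uV eqxx orbT.
  exact: subset_trans sFV (subsetUr _ _).
- split; first by apply/set0Pn; exists v; rewrite !inE eqxx.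
  have conu x : x \in v |: V -> connect (edge_rel ([set u; v] |: F)) u x.
    case/setU1P=> [->|xV]; first exact: connect1.
    by apply: (connect_sub _ (conV u x uV xV)) => a b ab; apply/connect1/sub1.
  have conu' x : x \in v |: V -> connect (edge_rel ([set u; v] |: F)) x u.
    case/setU1P=> [->|xV]; first exact: connect1.
    by apply: (connect_sub _ (conV x u xV uV)) => a b ab; apply/connect1/sub1.
  by move=> x y xV yV; apply: connect_trans (conu' x xV) (conu y yV).
- move=> p /andP [cp up].
  have [vp|vp] := boolP (v \in p); last first.
    apply: acyF; rewrite /ucycle up andbT.
    apply: (sub_in_cycle (P := mem p)) cp => [x y xp yp xy|]; last exact/allP.
    by apply: eq_edge xy _ _; apply: contraNneq vp => <-.
  have [i q Ep] := rot_to vp.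
  rewrite -(size_rot i) Ep.
  move: cp up; rewrite -(rot_cycle i) -(rot_uniq i) Ep.
  case/lastP: q {Ep} => [|q b] //=.
  rewrite rcons_path last_rcons => /andP [pq bv] /andP [_].
  have bu := nbr b (edgeC _ _ bv).
  case: q pq => [|a q] //= /andP [/nbr -> _].
  by rewrite bu mem_rcons inE eqxx.
Qed.

(** * Lists of edges as trees of a complete bipartite graph *)

(* A tree of a complete bipartite graph as a list of edges; read from the end,
   each edge adds exactly one new vertex. *)
Fixpoint grown (T : seq (nat * nat)) : bool :=
  if T is e :: T' then
    (T' == [::]) ||
    ((e.1 \in unzip1 T') (+) (e.2 \in unzip2 T')) && grown T'
  else false.

Definition tree_verts (T : seq (nat * nat)) : seq (nat + nat) :=
  map inl (unzip1 T) ++ map inr (unzip2 T).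

Section Realization.

Variables (s t : nat) (phi : nat -> 'I_s) (psi : nat -> 'I_t).

Definition place (x : nat + nat) : Kst s t :=
  match x with inl i => inl (phi i) | inr j => inr (psi j) end.

Definition place_edge (e : nat * nat) : {set Kst s t} :=
  [set place (inl e.1); place (inr e.2)].

(** Induction on the list: the exclusive or in [grown] says that one endpoint of the head edge is
    old and the other new, which is a leaf step. *)
Lemma grown_is_tree (T : seq (nat * nat)) :
  grown T ->
  {in unzip1 T &, injective phi} -> {in unzip2 T &, injective psi} ->
  is_tree [set x in map place (tree_verts T)] [set f in map place_edge T].
Proof.
elim: T => [//|[i j] T IH].
have vE : [set x in map place (tree_verts ((i, j) :: T))] =
    place (inl i) |: (place (inr j) |: [set x in map place (tree_verts T)]).
  apply/setP=> x; rewrite /tree_verts /= !map_cat /= !inE !mem_cat !inE.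
  by do !bool_congr.
have eE : [set f in map place_edge ((i, j) :: T)] =
    place_edge (i, j) |: [set f in map place_edge T].
  by apply/setP=> f; rewrite !inE.
(* Injectivity on the indices in use turns the index test of [grown] into membership of the placed
   vertex. *)
have inlE a U : {in a :: unzip1 U &, injective phi} ->
    (place (inl a) \in map place (tree_verts U)) = (a \in unzip1 U).
  move=> inj; apply/mapP/idP => [[[b|b]]|aU].
  - rewrite mem_cat => /orP [/mapP [b' b'U [->]]|/mapP [? _ ?] //].
    by case=> /inj ->; rewrite ?inE ?b'U ?eqxx ?orbT.
  - by [].
  - by exists (inl a); rewrite // mem_cat map_f.
have inrE a U : {in a :: unzip2 U &, injective psi} ->
    (place (inr a) \in map place (tree_verts U)) = (a \in unzip2 U).
  move=> inj; apply/mapP/idP => [[[b|b]]|aU].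
  - by [].
  - rewrite mem_cat => /orP [/mapP [? _ ?] //|/mapP [b' b'U [->]]].
    by case=> /inj ->; rewrite ?inE ?b'U ?eqxx ?orbT.
  - by exists (inr a); rewrite // mem_cat map_f ?orbT.
move=> gT inj1 inj2; rewrite vE eE.
have inj1T : {in unzip1 T &, injective phi}.
  by move=> a b aT bT; apply: inj1; rewrite inE ?aT ?bT orbT.
have inj2T : {in unzip2 T &, injective psi}.
  by move=> a b aT bT; apply: inj2; rewrite inE ?aT ?bT orbT.
move: gT => /= /orP [/eqP ET|/andP [xorT /IH /(_ inj1T inj2T) tT]].
  rewrite ET.
  have -> : [set x in map place (tree_verts [::])] = set0.
    by apply/setP=> x; rewrite !inE.
  have -> : [set f in map place_edge [::]] = set0 by apply/setP=> x; rewrite !inE.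
  (* A single edge is a leaf attached to a one-vertex tree. *)
  rewrite setU0 setUC setUC [place_edge _]setUC; apply: is_tree_leaf.
  - exact: is_tree1.
  - by rewrite inE.
  - by rewrite inE.
  - by [].
have absorb x : x \in map place (tree_verts T) ->
    x |: [set y in map place (tree_verts T)] = [set y in map place (tree_verts T)].
  by move=> xT; apply/setUidPr; rewrite sub1set inE.
move: xorT; rewrite -(inlE _ _ inj1) -(inrE _ _ inj2) => xorT.
case: (boolP (place (inl i) \in _)) xorT => iT /= jT.
  rewrite setUCA absorb //.
  by apply: is_tree_leaf => //; rewrite inE.
rewrite absorb //.
by rewrite [place_edge _]setUC; apply: is_tree_leaf => //; rewrite inE.
Qed.

End Realization.

(** * Computable certificates for colorings *)

(** The successor in ['I_k.+1] provides a color for [inord] and for the sets that are not edges. *)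
Definition bip_coloring (s t k : nat) (d : nat -> nat -> nat)
    (e : {set Kst s t}) : 'I_k.+1 :=
  if [pick p : 'I_s * 'I_t | e == [set inl p.1; inr p.2]] is Some p
  then inord (d p.1 p.2) else ord0.

Lemma bip_coloringE (s t k : nat) (d : nat -> nat -> nat) (i : 'I_s) (j : 'I_t) :
  bip_coloring k d [set inl i; inr j] = inord (d i j).
Proof.
rewrite /bip_coloring; case: pickP => [[a b] /eqP E|/(_ (i, j))]; last first.
  by rewrite eqxx.
move/setP: E => E; have := E (inl i); have := E (inr j).
by rewrite !inE !eqxx !orbT /= orbF => /esym/eqP [->] /esym/eqP [->].
Qed.

Definition rainbow_cert (d : nat -> nat -> nat) (k m n : nat)
    (T : seq (nat * nat)) : bool :=
  [&& grown T, all (fun e => [&& e.1 < m, e.2 < n & d e.1 e.2 < k]) T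
    & uniq [seq d e.1 e.2 | e <- T]].

Definition bip_verts (m n : nat) : seq (nat + nat) :=
  map inl (iota 0 m) ++ map inr (iota 0 n).

(** Trees failing the check are filtered out, so that one list [Ts] can serve several sizes [m],
    [n]. *)
Definition certifies (d : nat -> nat -> nat) (k m n : nat)
    (Ts : seq (seq (nat * nat))) : bool :=
  let Vs := [seq tree_verts T | T <- Ts & rainbow_cert d k m n T] in
  let W := bip_verts m n in
  all (fun x => all (fun y => all (fun z =>
    has (fun V => all (mem V) [:: x; y; z]) Vs) W) W) W.

(** [phi] and [psi] embed the [m] by [n] graph colored by [d0] into [Kst s t], preserving colors, so
    the certified trees are carried over to rainbow trees. *)
Lemma certifies_rainbow (s t m n k : nat) (phi : nat -> 'I_s) (psi : nat -> 'I_t)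
    (d d0 : nat -> nat -> nat) (Ts : seq (seq (nat * nat))) (S : {set Kst s t}) :
  certifies d0 k.+1 m n Ts ->
  {in gtn m &, injective phi} -> {in gtn n &, injective psi} ->
  {in gtn m & gtn n, forall i j, d (phi i) (psi j) = d0 i j} ->
  #|S| = 3 -> S \subset [set x in map (place phi psi) (bip_verts m n)] ->
  exists (V : {set Kst s t}) (F : {set {set Kst s t}}),
    is_rainbow_tree (bip_coloring k d) V F /\ S \subset V.
Proof.
move=> cert injphi injpsi dE S3 sS.
have [x [y [z [xW yW zW SE]]]] : exists x y z, [/\ x \in bip_verts m n,
    y \in bip_verts m n, z \in bip_verts m n &
    S = [set w in map (place phi psi) [:: x; y; z]]].
  have W w : w \in enum S -> exists2 x, x \in bip_verts m n & w = place phi psi x.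
    by rewrite mem_enum => /(subsetP sS); rewrite inE => /mapP.
  have: size (enum S) = 3 by rewrite -cardE.
  have SE : S = [set w in enum S] by apply/setP=> w; rewrite inE mem_enum.
  case: (enum S) W SE => [|a [|b [|c [|? ?]]]] //= W -> _.
  have [|x xW ->] := W a; first by rewrite !inE eqxx.
  have [|y yW ->] := W b; first by rewrite !inE eqxx ?orbT.
  have [|z zW ->] := W c; first by rewrite !inE eqxx ?orbT.
  by exists x, y, z.
move: cert => /allP /(_ x xW) /allP /(_ y yW) /allP /(_ z zW).
case/hasP=> _ /mapP [T + ->] /allP Txyz.
rewrite mem_filter => /andP [/and3P [gT /allP bT uT] _].
have in1 i : i \in unzip1 T -> i \in gtn m.
  by case/mapP=> e /bT /and3P [? ? ?] ->.
have in2 i : i \in unzip2 T -> i \in gtn n.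
  by case/mapP=> e /bT /and3P [? ? ?] ->.
exists [set w in map (place phi psi) (tree_verts T)].
exists [set f in map (place_edge phi psi) T]; split; last first.
  rewrite SE; apply/subsetP=> w; rewrite [w \in _]inE => /mapP [u /Txyz uT' ->].
  by rewrite inE map_f.
split.
  apply: grown_is_tree => // [a b /in1 am /in1 bm|a b /in2 am /in2 bm].
    exact: injphi.
  exact: injpsi.
move=> f g; rewrite ![_ \in [set _ in _]]inE => /mapP [e eT ->] /mapP [e' eT' ->] E.
(* The certificate bounds the colors by [k.+1], where [inord] loses nothing. *)
have colE u : u \in T ->
    bip_coloring k d (place_edge phi psi u) = d0 u.1 u.2 :> nat.
  by move=> /bT /and3P [um un uk]; rewrite /place_edge bip_coloringE dE // inordK.
have: d0 e.1 e.2 = d0 e'.1 e'.2 by rewrite -!colE // E.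
(* Equal colors at two positions of a duplicate-free list of colors force equal positions, hence
   equal edges. *)
move/eqP; rewrite -(nth_index (0, 0) eT) -(nth_index (0, 0) eT').
set f1 := fun e => d0 e.1 e.2.
rewrite -/(f1 (nth (0, 0) T (index e T))) -/(f1 (nth (0, 0) T (index e' T))).
rewrite -!(nth_map (0, 0) 0) ?index_mem //.
by rewrite nth_uniq ?size_map ?index_mem // => /eqP ->.
Qed.

Lemma certifies_has_3rainbow (s t k : nat) (d : nat -> nat -> nat)
    (Ts : seq (seq (nat * nat))) :
  0 < s -> 0 < t -> certifies d k.+1 s t Ts ->
  has_3rainbow_coloring (Kst s t) k.+1.
Proof.
case: s => // s _; case: t => // t _ cert.
exists (bip_coloring k d) => S S3.
apply: (certifies_rainbow (phi := inord) (psi := inord) cert) => //.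
- by move=> i j im jm /(congr1 val) /=; rewrite !inordK.
- by move=> i j im jm /(congr1 val) /=; rewrite !inordK.
- by move=> i j im jm; rewrite !inordK.
- apply/subsetP=> -[i|j] _; rewrite inE; apply/mapP.
    exists (inl (val i)); last by rewrite /= inord_val.
    by rewrite mem_cat map_f // mem_iota /=.
  exists (inr (val j)); last by rewrite /= inord_val.
  by rewrite mem_cat orbC map_f // mem_iota /=.
Qed.

(** * Reduction of large graphs to sides of size at most 5 *)

(* phi fixes 0 and 1 and lists the elements of A that are at least 2 first
   among the remaining values, from position 2 on. *)
Lemma compress_ord (s : nat) (A : {set 'I_s}) : 2 < s -> #|A| <= 3 ->
  exists phi : nat -> 'I_s,
  [/\ {in gtn s &, injective phi},
      {in gtn s, forall i, minn (phi i) 2 = minn i 2} &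
      forall a, a \in A -> exists2 i, i < minn s 5 & phi i = a].
Proof.
move=> s2 A3.
have s0 : 0 < s by apply: ltn_trans s2.
pose lo := [seq i : 'I_s <- enum 'I_s | i < 2].
pose hiA := [seq i <- enum A | 2 <= val i].
pose hi := [seq i : 'I_s <- enum 'I_s | (2 <= i) && (i \notin A)].
pose h := lo ++ hiA ++ hi.
have lo2 : map val lo = [:: 0; 1].
  rewrite /lo -(filter_map val (fun i => i < 2)) val_enum_ord.
  case: (s) s2 => [|[|s']] // _; rewrite /= (eq_in_filter (a2 := pred0)) ?filter_pred0 //.
  by move=> i; rewrite mem_iota => /andP [i2 _]; rewrite ltnNge i2.
have slo : size lo = 2 by rewrite -(size_map val) lo2.
have mem_lo i : (i \in lo) = (i < 2) by rewrite mem_filter mem_enum andbT.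
have mem_hiA i : (i \in hiA) = (2 <= i) && (i \in A).
  by rewrite mem_filter mem_enum.
have mem_hi i : (i \in hi) = (2 <= i) && (i \notin A).
  by rewrite mem_filter mem_enum andbT.
have uh : uniq h.
  have filter_enum_uniq (P B : pred 'I_s) : uniq [seq i <- enum B | P i].
    exact/filter_uniq/enum_uniq.
  rewrite !cat_uniq !filter_enum_uniq !andTb andbT; apply/andP; split.
    apply/hasPn=> i; rewrite /= mem_cat mem_lo mem_hiA mem_hi [i < 2]ltnNge.
    by case/orP=> [/andP [-> _]|/andP [-> _]].
  apply/hasPn=> i; rewrite /= mem_hiA mem_hi => /andP [_ /negPf ->].
  by rewrite andbF.
have hh i : i \in h.
  rewrite !mem_cat mem_lo mem_hiA mem_hi; case: ltnP => //= _.
  by case: (i \in A).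
have sh : size h = s.
  rewrite -[RHS](card_ord s) cardE; apply/perm_size/uniq_perm => //.
    exact: enum_uniq.
  by move=> i; rewrite hh mem_enum.
exists (nth (Ordinal s0) h); split.
- by move=> i j is_ js /eqP; rewrite nth_uniq ?sh // => /eqP.
- move=> i is_; rewrite nth_cat slo; case: ltnP => i2.
    have <- : nth 0 (map val lo) i = nth (Ordinal s0) lo i :> nat.
      by rewrite (nth_map (Ordinal s0)) ?slo.
    by rewrite lo2; case: i i2 {is_} => [|[|]].
  apply/minn_idPr.
  have: nth (Ordinal s0) (hiA ++ hi) (i - 2) \in hiA ++ hi.
    by rewrite mem_nth // -(ltn_add2l (size lo)) -size_cat sh slo subnKC.
  by rewrite mem_cat mem_hiA mem_hi => /orP [] /andP [].
move=> a aA; exists (index a h); last by rewrite nth_index.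
have ias : index a h < s by rewrite -[X in _ < X]sh index_mem.
rewrite leq_min ias /=.
(* All of [A] lies in [lo ++ hiA], of length at most 2 + 3; hence the bound 5. *)
have aloA : a \in lo ++ hiA.
  by rewrite mem_cat mem_lo mem_hiA aA andbT ltnNge orNb.
rewrite /h catA index_cat aloA.
have : index a (lo ++ hiA) < size (lo ++ hiA) by rewrite index_mem.
move/leq_trans; apply; rewrite size_cat slo ltnS ltnS.
by apply: leq_trans A3; rewrite size_filter (leq_trans (count_size _ _)) // -cardE.
Qed.

(** Since [d] sees an index only through its minimum with 2, renumbering the vertices from 2 on
    preserves colors. This moves [S] below 5 on each side, where finitely many sizes are checked. *)
Lemma certifies_blowup (s t k : nat) (d : nat -> nat -> nat)
    (Ts : seq (seq (nat * nat))) :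
  2 < s -> 2 < t ->
  (forall i j, d (minn i 2) (minn j 2) = d i j) ->
  all (fun m => all (fun n => certifies d k.+1 m n Ts) [:: 3; 4; 5])
    [:: 3; 4; 5] ->
  has_3rainbow_coloring (Kst s t) k.+1.
Proof.
move=> s2 t2 dmin /allP cert; exists (bip_coloring k d) => S S3.
have cardpre (X : finType) (f : X -> Kst s t) : injective f ->
    #|[set x | f x \in S]| <= 3.
  move=> injf; rewrite -S3 -(card_imset _ injf).
  by apply/subset_leq_card/subsetP=> _ /imsetP [x + ->]; rewrite inE.
have [phi [injphi minphi phiS]] := compress_ord s2 (cardpre _ inl (@inl_inj _ _)).
have [psi [injpsi minpsi psiS]] := compress_ord t2 (cardpre _ inr (@inr_inj _ _)).
have in35 u : 2 < u -> minn u 5 \in [:: 3; 4; 5].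
  by case: u => [|[|[|[|[|u]]]]] // _; rewrite (minn_idPr _).
have /allP /(_ _ (in35 _ t2)) certst := cert _ (in35 _ s2).
have lt_s i : i \in gtn (minn s 5) -> i \in gtn s.
  by rewrite !inE leq_min => /andP [].
have lt_t i : i \in gtn (minn t 5) -> i \in gtn t.
  by rewrite !inE leq_min => /andP [].
apply: (certifies_rainbow (phi := phi) (psi := psi) certst) => //.
- by move=> i j /lt_s im /lt_s jm; apply: injphi.
- by move=> i j /lt_t im /lt_t jm; apply: injpsi.
- by move=> i j /lt_s im /lt_t jm; rewrite -dmin minphi // minpsi // dmin.
- apply/subsetP=> -[a|b] xS; rewrite inE; apply/mapP.
    have [|i im ia] := phiS a; first by rewrite inE.
    exists (inl i); last by rewrite /= ia.
    by rewrite mem_cat map_f // mem_iota.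
  have [|i im ia] := psiS b; first by rewrite inE.
  exists (inr i); last by rewrite /= ia.
  by rewrite mem_cat orbC map_f // mem_iota.
Qed.

(** * Explicit colorings *)

(* The matrices and lists of trees below were found by computer search. *)
Definition table (M : seq (seq nat)) (i j : nat) : nat := nth 0 (nth [::] M i) j.

Lemma K33_has_3rainbow : has_3rainbow_coloring (Kst 3 3) 3.
Proof.
pose M := [:: [:: 1; 0; 2]; [:: 0; 1; 2]; [:: 2; 2; 0]].
pose Ts := [::
  [:: (2, 1); (1, 1); (0, 1)];
  [:: (0, 2); (0, 1); (0, 0)];
  [:: (2, 2); (1, 2); (1, 1)];
  [:: (2, 2); (0, 2); (0, 0)];
  [:: (1, 2); (1, 0); (0, 0)];
  [:: (2, 1); (1, 1); (1, 0)]].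
apply: (certifies_has_3rainbow (d := table M) (Ts := Ts)); [by []|by []|].
by vm_compute.
Qed.

Lemma K34_has_3rainbow : has_3rainbow_coloring (Kst 3 4) 4.
Proof.
pose M := [:: [:: 1; 1; 3; 0]; [:: 2; 3; 0; 0]; [:: 1; 1; 2; 1]].
pose Ts := [::
  [:: (1, 3); (2, 3); (2, 2); (0, 2)];
  [:: (1, 0); (1, 1); (0, 3); (0, 1)];
  [:: (2, 0); (2, 2); (1, 2); (1, 1)];
  [:: (2, 1); (2, 2); (0, 3); (0, 2)];
  [:: (2, 0); (2, 2); (0, 3); (0, 2)]].
apply: (certifies_has_3rainbow (d := table M) (Ts := Ts)); [by []|by []|].
by vm_compute.
Qed.

Lemma K35_has_3rainbow : has_3rainbow_coloring (Kst 3 5) 5.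
Proof.
pose M := [:: [:: 1; 2; 0; 3; 4]; [:: 2; 4; 3; 4; 1]; [:: 0; 2; 0; 1; 1]].
pose Ts := [::
  [:: (1, 2); (2, 2); (2, 4); (0, 4); (0, 1)];
  [:: (2, 3); (2, 0); (2, 1); (1, 2); (1, 1)];
  [:: (2, 1); (2, 0); (2, 4); (0, 4); (0, 3)];
  [:: (1, 0); (0, 4); (0, 3); (0, 2); (0, 0)]].
apply: (certifies_has_3rainbow (d := table M) (Ts := Ts)); [by []|by []|].
by vm_compute.
Qed.

Lemma K44_has_3rainbow : has_3rainbow_coloring (Kst 4 4) 5.
Proof.
pose M := [:: [:: 3; 2; 0; 3]; [:: 4; 0; 1; 2]; [:: 0; 2; 4; 3]; [:: 1; 2; 2; 4]].
pose Ts := [::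
  [:: (1, 2); (1, 1); (3, 1); (3, 3); (0, 3)];
  [:: (3, 0); (2, 3); (2, 2); (2, 1); (2, 0)];
  [:: (1, 2); (2, 2); (2, 0); (0, 1); (0, 0)];
  [:: (3, 0); (2, 0); (1, 3); (1, 0); (0, 0)]].
apply: (certifies_has_3rainbow (d := table M) (Ts := Ts)); [by []|by []|].
by vm_compute.
Qed.

Lemma Kst_has_3rainbow6 (s t : nat) : 2 < s -> 2 < t ->
  has_3rainbow_coloring (Kst s t) 6.
Proof.
move=> s2 t2.
(* Indices 0 and 1 are the singleton classes; [minn] sends all others to class 2. *)
pose d i j := table [:: [:: 3; 4; 5]; [:: 1; 4; 4]; [:: 0; 1; 2]] (minn i 2) (minn j 2).
pose Ts := [::
  [:: (2, 3); (2, 0); (1, 0); (0, 2); (0, 1); (0, 0)];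
  [:: (3, 0); (2, 1); (2, 2); (1, 2); (0, 2); (0, 0)];
  [:: (2, 2); (2, 1); (2, 0); (1, 4); (0, 4); (0, 0)];
  [:: (1, 1); (4, 1); (4, 2); (2, 0); (0, 2); (0, 0)];
  [:: (3, 4); (2, 0); (1, 3); (1, 0); (0, 4); (0, 0)];
  [:: (4, 2); (4, 0); (3, 1); (0, 3); (0, 1); (0, 0)];
  [:: (2, 0); (1, 0); (0, 2); (0, 1); (0, 0)];
  [:: (3, 0); (1, 1); (2, 1); (2, 3); (0, 3); (0, 0)];
  [:: (2, 4); (2, 0); (1, 1); (1, 0); (0, 3); (0, 0)];
  [:: (4, 0); (1, 1); (3, 1); (3, 2); (0, 2); (0, 0)];
  [:: (4, 0); (2, 3); (1, 3); (1, 0); (0, 4); (0, 0)];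
  [:: (3, 3); (3, 0); (1, 4); (1, 0); (0, 2); (0, 0)];
  [:: (4, 0); (3, 2); (3, 1); (0, 4); (0, 1); (0, 0)];
  [:: (4, 2); (3, 0); (2, 1); (0, 2); (0, 1); (0, 0)];
  [:: (4, 0); (2, 3); (1, 1); (1, 0); (0, 3); (0, 0)];
  [:: (3, 2); (3, 0); (1, 3); (0, 3); (0, 0)];
  [:: (2, 2); (2, 0); (1, 4); (1, 0); (0, 3); (0, 0)];
  [:: (3, 4); (3, 0); (2, 1); (0, 2); (0, 1); (0, 0)]].
apply: (certifies_blowup (d := d) (Ts := Ts)); [by []|by []| |].
  by move=> i j; rewrite /d -!minnA.
by vm_compute.
Qed.

(** * The lower bound of three colors *)

Lemma edges_adj (G : sgraph) (x y : G) : [set x; y] \in edges G -> adj x y.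
Proof.
case/imset2P=> a b _; rewrite inE => /andP [_ ab] E.
have := set22 a b; have := set21 a b; rewrite -E !inE.
case/orP=> /eqP ax /orP [] /eqP bx; move: ab; rewrite ax bx ?adj_irrefl //.
by rewrite adj_sym.
Qed.

Lemma rainbow_edges_card (G : sgraph) (k : nat) (c : {set G} -> 'I_k)
    (V : {set G}) (F : {set {set G}}) :
  is_rainbow_tree c V F -> #|F| <= k.
Proof.
case=> _ injc; rewrite -(card_in_imset injc) -[k in _ <= k]card_ord.
exact: max_card.
Qed.

(* Edges at distinct vertices of the left side are distinct, so a tree through
   three of them has at least three edges. *)
Lemma Kst_3rainbow_lb (s t k : nat) : 2 < s ->
  has_3rainbow_coloring (Kst s t) k -> 3 <= k.
Proof.
move=> s2 [c rc].
pose v (i : 'I_3) : Kst s t := inl (widen_ord s2 i).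
have vinj : injective v by move=> i j [/val_inj].
pose S := [set v i | i : 'I_3].
have S3 : #|S| = 3 by rewrite card_imset ?card_ord.
have [V [F [rT sSV]]] := rc S S3.
apply: leq_trans (rainbow_edges_card rT).
have [[[/subsetP sFE _] [_ conV] _] _] := rT.
have vV i : v i \in V by apply/(subsetP sSV)/imsetP; exists i.
have /fin_all_exists [y yF] i : exists y : 'I_t, [set v i; inr y] \in F.
  (* Any second vertex of [S] will do: the tree has a path from [v i] to [v j], whose first edge
     leaves [v i] for the right side. *)
  pose j : 'I_3 := if i == ord0 then ord_max else ord0.
  have ij : v i != v j.
    apply/eqP => /vinj; rewrite /j; case: (eqVneq i ord0) => [->|i0] // ij.
    by rewrite ij eqxx in i0.
  have /connectP [[|x p] /= pF E] := conV _ _ (vV i) (vV j).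
    by rewrite E eqxx in ij.
  case/andP: pF; rewrite edge_relE => ixF _.
  have := edges_adj (sFE _ ixF).
  by case: x ixF {E} => // x; exists x.
rewrite -[3]card_ord -(card_imset predT (f := fun i => [set v i; inr (y i)])).
  by apply/subset_leq_card/subsetP=> _ /imsetP [i _ ->].
(* [v i] is the only left endpoint of its edge, so the edge determines [i]. *)
move=> i j /setP /(_ (v i)); rewrite !inE eqxx /= orbF => /esym /eqP.
exact: vinj.
Qed.

(** * Existence of the index and the final case split *)

(** Descent to the least number of colors; colorability is a mere proposition, hence the appeal to
    excluded middle. *)
Lemma is_rx3_exists (G : sgraph) (k : nat) :
  has_3rainbow_coloring G k -> exists2 m, is_rx3 G m & m <= k.
Proof.
elim/ltn_ind: k => k IH Gk.
have [[j [jk Gj]]|min_k] := classic (exists j, j < k /\ has_3rainbow_coloring G j).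
  have [m Gm mj] := IH j jk Gj.
  by exists m => //; apply: leq_trans mj (ltnW jk).
exists k => //; split=> // j Gj; rewrite leqNgt; apply/negP => jk.
by case: min_k; exists j.
Qed.

Lemma Kst_has_3rainbow_min (s t : nat) : 3 <= s -> s <= t ->
  has_3rainbow_coloring (Kst s t) (minn 6 (s + t - 3)).
Proof.
move=> s3 st; have t3 := leq_trans s3 st.
have [st9|st9] := leqP 9 (s + t).
  by rewrite (minn_idPl (leq_sub2r 3 st9)); apply: Kst_has_3rainbow6.
have s4 : s < 5.
  rewrite ltnNge; apply/negP => s5; move: st9; rewrite ltnNge => /negP [].
  exact: leq_trans (leq_add s5 (leq_trans s5 st)).
have t6 : t < 6 by rewrite -(ltn_add2l s) (leq_trans st9) // -[9]/(3 + 6) leq_add2r.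
(* With 3 <= s <= t and s + t <= 8 only (3,3), (3,4), (3,5) and (4,4) survive. *)
case: s s3 s4 st st9 => [|[|[|[|[|s]]]]] // _ _;
  case: t t3 t6 => [|[|[|[|[|[|t]]]]]] // _ _ _ _.
- exact: K33_has_3rainbow.
- exact: K34_has_3rainbow.
- exact: K35_has_3rainbow.
- exact: K44_has_3rainbow.
Qed.

Theorem theorem3p1 :
  (forall s t : nat, 3 <= s -> s <= t ->
     exists k : nat, is_rx3 (Kst s t) k /\ k <= minn 6 (s + t - 3)) /\
  (exists s t : nat, [/\ 3 <= s, s <= t & is_rx3 (Kst s t) (minn 6 (s + t - 3))]).
Proof.
split=> [s t s3 st|].
  by have [k] := is_rx3_exists (Kst_has_3rainbow_min s3 st); exists k.
exists 3, 3; split=> //; split; first exact: Kst_has_3rainbow_min.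
by move=> j; apply: Kst_3rainbow_lb.
Qed.
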